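(* Let $AB_1A'D_1$ be a hyperbolic diametral quadrangle with right angles at the opposite vertices $B_1, D_1$. Consider the line $a_*=AA'$ and the line $c_*$ through $A'$ perpendicular to $B_1D_1$. Then the bisectors of the angle $\widehat{B_1A'D_1}$ are also the bisectors of the angle $\widehat{a_*c_*}$.
   Context: A quadrangle (quadrilateral) in the hyperbolic plane, with vertices listed in cyclic order, is called diametral if it has two right angles located at opposite vertices. The bisectors of the angle $\widehat{B_1A'D_1}$ are the two (mutually perpendicular) lines through $A'$ bisecting the angles formed by the lines $A'B_1$ and $A'D_1$. The bisectors of the angle $\widehat{a_*c_*}$ are the two lines through $A'$ bisecting the angles formed by the lines $a_*$ and $c_*$. If $a_*=c_*$, these are understood to be the line $a_*$ itself and its perpendicular at $A'$. *)

(* Defs.v *)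
From HB Require Import structures.
From mathcomp Require Import all_boot all_order all_algebra.
From mathcomp Require Import all_classical all_reals all_analysis.

Set Implicit Arguments.
Unset Strict Implicit.
Unset Printing Implicit Defensive.

Import Order.TTheory GRing.Theory Num.Theory.

Local Open Scope classical_set_scope.
Local Open Scope ring_scope.

(* The hyperbolic plane is the hyperboloid model: the sheet x_0 > 0 of
   <x, x> = -1 in R^3, for the Lorentzian form of signature (-, +, +). *)

Definition lorentz (R : realType) (u v : 'rV[R]_3) : R :=
  - (u 0 0 * v 0 0) + u 0 1 * v 0 1 + u 0 2%:R * v 0 2%:R.

Definition in_hyperboloid (R : realType) (v : 'rV[R]_3) : bool :=
  (lorentz v v == -1) && (0 < v 0 0).

Record hpoint (R : realType) := HPoint {
  hvec : 'rV[R]_3;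
  hvecP : in_hyperboloid hvec
}.

HB.instance Definition _ (R : realType) := [isSub for @hvec R].
HB.instance Definition _ (R : realType) := [Choice of hpoint R by <:].

(* Geodesics are the traces on the hyperboloid of the linear planes that
   meet it; this is a line only when X != Y. *)
Definition line_through (R : realType) (X Y : hpoint R) : set (hpoint R) :=
  [set Z | exists s t : R, hvec Z = s *: hvec X + t *: hvec Y].

Definition is_line (R : realType) (l : set (hpoint R)) : Prop :=
  exists X Y : hpoint R, X != Y /\ l = line_through X Y.

Definition collinear (R : realType) (X Y Z : hpoint R) : Prop :=
  exists l : set (hpoint R), [/\ is_line l, l X, l Y & l Z].

(* The Lorentz-orthogonal projection of X to the tangent plane P^perp at P;
   it is the direction at P of the ray PX, and is spacelike when X != P. *)
Definition direction (R : realType) (P X : hpoint R) : 'rV[R]_3 :=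
  hvec X + lorentz (hvec P) (hvec X) *: hvec P.

(* The measure in [0, pi] of the angle XPY with vertex P; meaningful when
   X != P and Y != P. *)
Definition angle (R : realType) (X P Y : hpoint R) : R :=
  let u := direction P X in
  let v := direction P Y in
  acos (lorentz u v / (Num.sqrt (lorentz u u) * Num.sqrt (lorentz v v))).

Definition perpendicular (R : realType) (l m : set (hpoint R)) : Prop :=
  exists P X Y : hpoint R,
    [/\ l P /\ m P, l X /\ X != P, m Y /\ Y != P & angle X P Y = pi / 2].

(* The ray PZ halves the angle XPY. The additivity condition puts Z inside the
   angle; for a null angle it forces PZ to be the common ray, and for a straight
   angle the equality of the halves makes PZ perpendicular to it. *)
Definition bisects (R : realType) (X P Y Z : hpoint R) : Prop :=
  angle X P Z = angle Z P Y /\ angle X P Z + angle Z P Y = angle X P Y.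

(* The bisectors at P of two lines a, b through P. X and Y range over both
   sides of P, so that all the angles formed by a and b are considered. When
   a = b, the angles are null or straight, and the bisectors are a itself and
   its perpendicular at P. *)
Definition bisectors (R : realType) (P : hpoint R) (a b : set (hpoint R)) :
    set (set (hpoint R)) :=
  [set l | [/\ is_line l, l P &
    exists X Y Z : hpoint R,
      [/\ a X /\ X != P, b Y /\ Y != P, l Z /\ Z != P & bisects X P Y Z]]].

(* Vertices in cyclic order; self-crossing quadrangles are allowed. *)
Definition quadrangle (R : realType) (A B C D : hpoint R) : Prop :=
  [/\ ~ collinear A B C, ~ collinear B C D, ~ collinear C D A
    & ~ collinear D A B].

Definition diametral (R : realType) (A B C D : hpoint R) : Prop :=
  quadrangle A B C D /\
  ((angle D A B = pi / 2 /\ angle B C D = pi / 2) \/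
   (angle A B C = pi / 2 /\ angle C D A = pi / 2)).

(* Main.v *)
(* Identify directions at A' with complex numbers. The line in direction z
   bisects the lines in directions x and y iff x y / z^2 is real, so it suffices
   that b d / (a q) is real, where b, d, a, q are the directions at A' of B1, D1,
   A and the foot Q of c. In the Klein model centred at A' the right angles at
   B1, D1 and Q are Euclidean: |b|^2 = a.b, |d|^2 = a.d, and q is orthogonal to
   b - d, i.e. q is a real multiple of i (b - d). Up to real factors,
   b d conj(a q) then has imaginary part
   Re (conj(a) (|b|^2 d - |d|^2 b)) = |b|^2 (a.d) - |d|^2 (a.b) = 0. *)
Require Import Defs.
From mathcomp Require Import all_boot all_order all_algebra.
From mathcomp Require Import all_classical all_reals all_analysis.
From mathcomp Require Import ring lra.

Import Order.TTheory GRing.Theory Num.Theory.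

Local Open Scope classical_set_scope.
Local Open Scope ring_scope.

(** * The Lorentz form and its Euclidean frame at a point *)

Lemma lorentzC {R : realType} (u v : 'rV[R]_3) : lorentz u v = lorentz v u.
Proof. rewrite /lorentz; ring. Qed.

Lemma lorentz_linear {R : realType} (w u v : 'rV[R]_3) (s t : R) :
  lorentz w (s *: u + t *: v) = s * lorentz w u + t * lorentz w v.
Proof. rewrite /lorentz !mxE; ring. Qed.

Lemma hpoint_norm {R : realType} (X : hpoint R) :
  lorentz (hvec X) (hvec X) = -1.
Proof. by have /andP[/eqP] := hvecP X. Qed.

Lemma hvec0_gt0 {R : realType} (X : hpoint R) : 0 < hvec X 0 0.
Proof. by have /andP[] := hvecP X. Qed.

Lemma row3P {R : realType} (u v : 'rV[R]_3) :
  u 0 0 = v 0 0 -> u 0 1 = v 0 1 -> u 0 2%:R = v 0 2%:R -> u = v.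
Proof.
move=> h0 h1 h2; apply/rowP; case=> [[|[|[|//]]] hi].
- by have -> : Ordinal hi = 0 by apply: val_inj.
- by have -> : Ordinal hi = 1 by apply: val_inj.
- by have -> : Ordinal hi = 2%:R by apply: val_inj.
Qed.

(* [coord1 P] and [coord2 P] are the spatial coordinates after the boost that
   sends [P] to (1, 0, 0); restricted to the tangent plane at [P] they form a
   Euclidean frame. *)
Definition boost_scale {R : realType} (P : hpoint R) (v : 'rV[R]_3) : R :=
  (v 0 0 - lorentz (hvec P) v) / (1 + hvec P 0 0).

Definition coord1 {R : realType} (P : hpoint R) (v : 'rV[R]_3) : R :=
  v 0 1 - hvec P 0 1 * boost_scale P v.

Definition coord2 {R : realType} (P : hpoint R) (v : 'rV[R]_3) : R :=
  v 0 2%:R - hvec P 0 2%:R * boost_scale P v.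

Lemma boost_scaleE {R : realType} (P : hpoint R) (v : 'rV[R]_3) :
  (1 + hvec P 0 0) * boost_scale P v = v 0 0 - lorentz (hvec P) v.
Proof.
rewrite /boost_scale mulrC divfK //.
by apply: lt0r_neq0; apply: addr_gt0 => //; exact: hvec0_gt0.
Qed.

Lemma coord1_linear {R : realType} (P : hpoint R) (u v : 'rV[R]_3) (s t : R) :
  coord1 P (s *: u + t *: v) = s * coord1 P u + t * coord1 P v.
Proof. rewrite /coord1 /boost_scale lorentz_linear !mxE; ring. Qed.

Lemma coord2_linear {R : realType} (P : hpoint R) (u v : 'rV[R]_3) (s t : R) :
  coord2 P (s *: u + t *: v) = s * coord2 P u + t * coord2 P v.
Proof. rewrite /coord2 /boost_scale lorentz_linear !mxE; ring. Qed.

Lemma boost_scale_base {R : realType} (P : hpoint R) : boost_scale P (hvec P) = 1.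
Proof.
rewrite /boost_scale hpoint_norm opprK addrC divff //.
by apply: lt0r_neq0; apply: addr_gt0 => //; exact: hvec0_gt0.
Qed.

Lemma coord1_base {R : realType} (P : hpoint R) : coord1 P (hvec P) = 0.
Proof. by rewrite /coord1 boost_scale_base mulr1 subrr. Qed.

Lemma coord2_base {R : realType} (P : hpoint R) : coord2 P (hvec P) = 0.
Proof. by rewrite /coord2 boost_scale_base mulr1 subrr. Qed.

(** The boost preserves the form, and the time coordinate of the image of [u] is
    [- lorentz (hvec P) u]. *)
Lemma lorentz_coord {R : realType} (P : hpoint R) (u v : 'rV[R]_3) :
  lorentz u v = coord1 P u * coord1 P v + coord2 P u * coord2 P v
                - lorentz (hvec P) u * lorentz (hvec P) v.
Proof.
have hP := hpoint_norm P; have hu := boost_scaleE P u.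
have hv := boost_scaleE P v; move: hP hu hv; rewrite /coord1 /coord2.
move: (boost_scale P u) (boost_scale P v) => m n; rewrite /lorentz.
set p := hvec P; set p0 := p 0 0; set p1 := p 0 1; set p2 := p 0 2%:R.
set u0 := u 0 0; set v0 := v 0 0; set u1 := u 0 1; set v1 := v 0 1.
set u2 := u 0 2%:R; set v2 := v 0 2%:R => hP hu hv.
have hpu : p1 * u1 + p2 * u2 = u0 - (1 + p0) * m + p0 * u0 by rewrite hu; ring.
have hpv : p1 * v1 + p2 * v2 = v0 - (1 + p0) * n + p0 * v0 by rewrite hv; ring.
have hpp : p1 * p1 + p2 * p2 = p0 * p0 - 1 by rewrite -hP; ring.
(* Grouped so that the spatial part of [P] occurs only in the three sums that [hpu], [hpv] and [hpp]
   eliminate. *)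
transitivity (u1 * v1 + u2 * v2 - n * (p1 * u1 + p2 * u2)
  - m * (p1 * v1 + p2 * v2) + m * n * (p1 * p1 + p2 * p2)
  - (p0 * u0 - (p1 * u1 + p2 * u2)) * (p0 * v0 - (p1 * v1 + p2 * v2))); last by ring.
rewrite hpu hpv hpp; ring.
Qed.

(** Vanishing coordinates make [hvec X] a multiple [m] of [hvec P]; the norm gives [m ^+ 2 = 1], and
    lying on the same sheet excludes [m = -1]. *)
Lemma coord_eq0 {R : realType} (P X : hpoint R) :
  coord1 P (hvec X) = 0 -> coord2 P (hvec X) = 0 -> X = P.
Proof.
have hP := hpoint_norm P; have hX := boost_scaleE P (hvec X).
have nX := hpoint_norm X; have X0 := hvec0_gt0 X; have P0 := hvec0_gt0 P.
rewrite /coord1 /coord2 => /eqP; rewrite subr_eq0 => /eqP h1.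
move=> /eqP; rewrite subr_eq0 => /eqP h2.
move: (boost_scale _ _) hX h1 h2 => m hX h1 h2.
have h0 : hvec X 0 0 = hvec P 0 0 * m.
  have p0 : 1 + hvec P 0 0 != 0 by lra.
  apply: (mulfI p0); move: hX hP; rewrite /lorentz h1 h2 => hX hP.
  have hPm := congr1 ( *%R m) hP; lra.
have m1 : m = 1.
  have m0 : 0 < m by move: X0; rewrite h0 pmulr_rgt0.
  have : m ^+ 2 = 1.
    have hPm := congr1 ( *%R (m ^+ 2)) hP.
    move: nX hPm; rewrite /lorentz h1 h2 h0; lra.
  by move=> /eqP; rewrite sqrf_eq1 => /orP[] /eqP // hm; lra.
by apply: val_inj; apply: row3P; rewrite ?h0 ?h1 ?h2 m1 mulr1.
Qed.

(** * Angles and angle bisectors in the Euclidean plane *)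

Lemma vec_normsq_eq0 {R : realType} (x1 x2 : R) :
  x1 * x1 + x2 * x2 = 0 -> x1 = 0 /\ x2 = 0.
Proof.
move=> /eqP; rewrite -!expr2 paddr_eq0 ?sqr_ge0 // !sqrf_eq0.
by case/andP=> /eqP -> /eqP ->.
Qed.

Definition plane_angle {R : realType} (x1 x2 y1 y2 : R) : R :=
  acos ((x1 * y1 + x2 * y2) /
        (Num.sqrt (x1 * x1 + x2 * x2) * Num.sqrt (y1 * y1 + y2 * y2))).

(* In complex notation, this is - Im (x y conj(z)^2). *)
Definition isogonal {R : realType} (x1 x2 y1 y2 z1 z2 : R) : R :=
  (x1 * z1 + x2 * z2) * (y1 * z2 - y2 * z1) +
  (x1 * z2 - x2 * z1) * (y1 * z1 + y2 * z2).

(** For [a] nonnegative, [acos a] is at most [pi / 2], so its double stays in the range where [acos]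
    inverts [cos]. *)
Lemma acos_double {R : realType} {a : R} :
  0 <= a -> a <= 1 -> acos a + acos a = acos (a ^+ 2 *+ 2 - 1).
Proof.
move=> a0 a1; have ha : -1 <= a <= 1 by apply/andP; split; lra.
have h : cos (acos a) = a by have [] := acos_def ha.
rewrite -mulr2n -[in RHS]h -cos_mulr2n cosK // in_itv /=.
have b0 := acos_ge0 ha.
apply/andP; split; first by rewrite mulr2n addr_ge0.
rewrite leNgt; apply/negP => hlt.
have bpi := acos_lepi ha.
have : cos (acos a) < cos (pi / 2).
  have p0 := pi_gt0 R.
  have hb : acos a \in `[0, pi] by rewrite in_itv /= b0.
  have hp : pi / 2 \in `[0, (pi : R)].
    by rewrite in_itv /=; apply/andP; split; lra.
  by rewrite (ltr_cos hp hb); move: hlt; rewrite mulr2n; lra.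
by rewrite h cos_pihalf; lra.
Qed.

(** Cauchy-Schwarz, whose defect is the square of the cross product. For a zero vector the quotient
    is 0 by convention. *)
Lemma cos_plane_angle {R : realType} (x1 x2 y1 y2 : R) :
  -1 <= (x1 * y1 + x2 * y2) /
        (Num.sqrt (x1 * x1 + x2 * x2) * Num.sqrt (y1 * y1 + y2 * y2)) <= 1.
Proof.
set X := x1 * x1 + x2 * x2; set Y := y1 * y1 + y2 * y2.
have X0 : 0 <= X by rewrite addr_ge0 // -expr2 sqr_ge0.
have Y0 : 0 <= Y by rewrite addr_ge0 // -expr2 sqr_ge0.
rewrite -sqrtrM //; set s := x1 * y1 + x2 * y2.
have [XY0|XY0] := leP (X * Y) 0.
  by rewrite ler0_sqrtr // invr0 mulr0; apply/andP; split; lra.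
have q0 : 0 < Num.sqrt (X * Y) by rewrite sqrtr_gt0.
rewrite ler_pdivrMr // ler_pdivlMr // mul1r mulN1r -ler_norml.
rewrite -sqrtr_sqr ler_wsqrtr // -subr_ge0.
have -> : X * Y - s ^+ 2 = (x1 * y2 - x2 * y1) ^+ 2 by rewrite /X /Y /s; ring.
exact: sqr_ge0.
Qed.

Lemma plane_angle_right {R : realType} (x1 x2 y1 y2 : R) :
  plane_angle x1 x2 y1 y2 = pi / 2 -> x1 * y1 + x2 * y2 = 0.
Proof.
move=> /(congr1 cos); rewrite cos_pihalf acosK; last first.
  by rewrite in_itv /= cos_plane_angle.
(* The quotient also vanishes when its denominator does; then one vector is zero, and so is the dot
   product. *)
move=> /eqP; rewrite mulf_eq0 invr_eq0 mulf_eq0 !sqrtr_eq0.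
have sq (a b : R) : a * a + b * b <= 0 -> a = 0 /\ b = 0.
  move=> h; apply: vec_normsq_eq0; apply: le_anti; rewrite h /=.
  by rewrite addr_ge0 // -expr2 sqr_ge0.
by case/or3P=> [/eqP//|/sq[-> ->]|/sq[-> ->]]; ring.
Qed.

Lemma polar {R : realType} (x1 x2 : R) : ~ (x1 = 0 /\ x2 = 0) ->
  exists p a b : R,
    [/\ 0 < p, x1 = p * a, x2 = p * b & a * a + b * b = 1].
Proof.
move=> x0; set p := Num.sqrt (x1 * x1 + x2 * x2).
have X0 : 0 <= x1 * x1 + x2 * x2 by rewrite addr_ge0 // -expr2 sqr_ge0.
have p0 : 0 < p.
  rewrite sqrtr_gt0 lt_neqAle X0 andbT; apply/eqP => h.
  by apply: x0; apply: vec_normsq_eq0.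
have pn0 : p != 0 by rewrite gt_eqF.
have pp : p ^+ 2 = x1 * x1 + x2 * x2 by rewrite sqr_sqrtr.
exists p, (x1 / p), (x2 / p); split=> //; try by field.
have -> : x1 / p * (x1 / p) + x2 / p * (x2 / p) =
          (x1 * x1 + x2 * x2) / p ^+ 2 by field.
by rewrite -pp divff // expf_neq0.
Qed.

Lemma plane_angle_polar {R : realType} (p q a b c d : R) : 0 < p -> 0 < q ->
  a * a + b * b = 1 -> c * c + d * d = 1 ->
  plane_angle (p * a) (p * b) (q * c) (q * d) = acos (a * c + b * d).
Proof.
move=> p0 q0 ab cd; rewrite /plane_angle.
have -> : p * a * (p * a) + p * b * (p * b) = p ^+ 2 * (a * a + b * b) by ring.
have -> : q * c * (q * c) + q * d * (q * d) = q ^+ 2 * (c * c + d * d) by ring.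
rewrite ab cd !mulr1 !sqrtr_sqr !gtr0_norm //; congr acos; field.
by rewrite !gt_eqF.
Qed.

Lemma unit_dot_bound {R : realType} {a b c d : R} :
  a * a + b * b = 1 -> c * c + d * d = 1 -> -1 <= a * c + b * d <= 1.
Proof.
move=> ab cd; have := cos_plane_angle a b c d.
by rewrite ab cd sqrtr1 mulr1 divr1.
Qed.

(** For unit vectors let [A] be the common cosine of the two halves and [B], [D] their signed sines,
    measured from [x] and from [y] to [z]. The sum of the halves being the whole angle gives
    [B * D = A ^+ 2 - 1], while both squares are [1 - A ^+ 2]; hence [B + D = 0], and [isogonal] is
    a multiple of [A * (B + D)]. *)
Lemma bisecting_isogonal {R : realType} {x1 x2 y1 y2 z1 z2 : R} :
  ~ (x1 = 0 /\ x2 = 0) -> ~ (y1 = 0 /\ y2 = 0) -> ~ (z1 = 0 /\ z2 = 0) ->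
  plane_angle x1 x2 z1 z2 = plane_angle z1 z2 y1 y2 ->
  plane_angle x1 x2 z1 z2 + plane_angle z1 z2 y1 y2 =
    plane_angle x1 x2 y1 y2 ->
  isogonal x1 x2 y1 y2 z1 z2 = 0.
Proof.
move=> /polar[p [a [b [p0 -> -> ab]]]] /polar[q [c [d [q0 -> -> cd]]]].
move=> /polar[r [e [f [r0 -> -> ef]]]].
rewrite !plane_angle_polar //.
have hA := unit_dot_bound ab ef; have hA' := unit_dot_bound ef cd.
have hG := unit_dot_bound ab cd.
move=> hE; rewrite -hE => hS.
have AA : a * e + b * f = e * c + f * d.
  by have := congr1 cos hE; rewrite !acosK // in_itv.
(* Twice the half angle is an angle, hence at most [pi]. *)
have A0 : 0 <= a * e + b * f.
  have [_ <-] := acos_def hA; apply: cos_ge0_pihalf.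
  have h1 := acos_ge0 hA; have h2 := acos_lepi hG; have h3 := pi_ge0 R.
  by apply/andP; split; lra.
have A1 : a * e + b * f <= 1 by case/andP: hA.
have GA : a * c + b * d = (a * e + b * f) ^+ 2 *+ 2 - 1.
  have hD := acos_double A0 A1; rewrite hS in hD.
  have := congr1 cos hD; rewrite !acosK ?in_itv //=.
  have := sqr_ge0 (a * e + b * f); have : (a * e + b * f) ^+ 2 <= 1.
    by rewrite expr_le1.
  by move=> *; apply/andP; split; lra.
pose B := a * f - b * e; pose D := c * f - d * e.
set A := a * e + b * f in AA GA *.
have BB : B ^+ 2 = 1 - A ^+ 2.
  transitivity ((a * a + b * b) * (e * e + f * f) - A ^+ 2).
    by rewrite /A /B; ring.
  by rewrite ab ef mul1r.
have DD : D ^+ 2 = 1 - A ^+ 2.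
  transitivity ((c * c + d * d) * (e * e + f * f) - (e * c + f * d) ^+ 2).
    by rewrite /D; ring.
  by rewrite cd ef mul1r AA.
have BD : B * D = A ^+ 2 - 1.
  transitivity ((a * c + b * d) * (e * e + f * f) - A * (e * c + f * d)).
    by rewrite /A /B /D; ring.
  by rewrite ef mulr1 -AA GA; ring.
have /eqP : (B + D) ^+ 2 = 0.
  transitivity (B ^+ 2 + D ^+ 2 + B * D *+ 2); first by ring.
  by rewrite BB DD BD; ring.
rewrite sqrf_eq0 => /eqP BD0.
transitivity (p * q * r ^+ 2 * (A * D + B * (e * c + f * d))).
  by rewrite /isogonal /A /B /D; ring.
have -> : A * D + B * (e * c + f * d) = A * (B + D) by rewrite -AA; ring.
by rewrite BD0 !mulr0.
Qed.

(** The last positivity hypothesis concerns the real part of x y conj(z)^2. For unit vectors this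
    number has modulus 1 and is real and positive, hence is 1, so x conj(z) and y conj(z) are
    conjugate: equal cosines, opposite sines. A nonnegative cosine then permits doubling the
    angle. *)
Lemma isogonal_bisecting {R : realType} {x1 x2 y1 y2 z1 z2 : R} :
  ~ (x1 = 0 /\ x2 = 0) -> ~ (y1 = 0 /\ y2 = 0) -> ~ (z1 = 0 /\ z2 = 0) ->
  isogonal x1 x2 y1 y2 z1 z2 = 0 ->
  0 <= x1 * z1 + x2 * z2 ->
  0 < (x1 * z1 + x2 * z2) * (y1 * z1 + y2 * z2) -
      (x1 * z2 - x2 * z1) * (y1 * z2 - y2 * z1) ->
  plane_angle x1 x2 z1 z2 = plane_angle z1 z2 y1 y2 /\
  plane_angle x1 x2 z1 z2 + plane_angle z1 z2 y1 y2 =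
    plane_angle x1 x2 y1 y2.
Proof.
move=> /polar[p [a [b [p0 -> -> ab]]]] /polar[q [c [d [q0 -> -> cd]]]].
move=> /polar[r [e [f [r0 -> -> ef]]]].
pose A := a * e + b * f; pose A' := e * c + f * d.
pose B := a * f - b * e; pose D := c * f - d * e.
have pq0 : 0 < p * q * r ^+ 2 by rewrite !mulr_gt0 // exprn_gt0.
have -> : isogonal (p * a) (p * b) (q * c) (q * d) (r * e) (r * f) =
  p * q * r ^+ 2 * (A * D + B * A') by rewrite /isogonal /A /B /A' /D; ring.
have -> : p * a * (r * e) + p * b * (r * f) = p * r * A by rewrite /A; ring.
have -> : p * r * A * (q * c * (r * e) + q * d * (r * f)) -
    (p * a * (r * f) - p * b * (r * e)) * (q * c * (r * f) - q * d * (r * e))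
    = p * q * r ^+ 2 * (A * A' - B * D) by rewrite /A' /B /D; ring.
move=> /eqP; rewrite mulf_eq0 gt_eqF //= => /eqP h0.
move=> A0 hpos; have {}A0 : 0 <= A by move: A0; rewrite pmulr_rge0 // mulr_gt0.
have {}hpos : 0 < A * A' - B * D by move: hpos; rewrite pmulr_rgt0.
rewrite !plane_angle_polar // -/A -/A'.
have AB : A ^+ 2 + B ^+ 2 = 1.
  transitivity ((a * a + b * b) * (e * e + f * f)); last by rewrite ab ef mul1r.
  by rewrite /A /B; ring.
have CD : A' ^+ 2 + D ^+ 2 = 1.
  transitivity ((c * c + d * d) * (e * e + f * f)); last by rewrite cd ef mul1r.
  by rewrite /A' /D; ring.
have h1 : A * A' - B * D = 1.
  have : (A * A' - B * D) ^+ 2 = 1.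
    transitivity ((A ^+ 2 + B ^+ 2) * (A' ^+ 2 + D ^+ 2)
                  - (A * D + B * A') ^+ 2); first by ring.
    by rewrite AB CD h0 expr0n subr0 mul1r.
  by move=> /eqP; rewrite sqrf_eq1 => /orP[] /eqP // hm; lra.
(* The two squares add up to [AB + CD - 2 * h1], that is to 2 - 2 = 0. *)
have [hA hB] : A - A' = 0 /\ B + D = 0 by apply: vec_normsq_eq0; nra.
have AE : A' = A by lra.
have DE : D = - B by lra.
have A1 : A <= 1 by case/andP: (unit_dot_bound ab ef).
rewrite AE acos_double //; split=> //; congr acos.
have -> : a * c + b * d = A * A' + B * D.
  transitivity ((a * c + b * d) * (e * e + f * f)); first by rewrite ef mulr1.
  by rewrite /A /A' /B /D; ring.
by rewrite AE DE -AB; ring.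
Qed.

Lemma parallel_scale {R : realType} {x1 x2 y1 y2 : R} :
  ~ (x1 = 0 /\ x2 = 0) -> x1 * y2 = x2 * y1 ->
  exists k : R, y1 = k * x1 /\ y2 = k * x2.
Proof.
move=> x0 xy; set n := x1 * x1 + x2 * x2.
have n0 : n != 0 by apply/eqP => /vec_normsq_eq0.
have h1 := congr1 ( *%R x1) xy; have h2 := congr1 ( *%R x2) xy.
exists ((x1 * y1 + x2 * y2) / n); split; apply: (mulfI n0).
- transitivity ((x1 * y1 + x2 * y2) * x1); last by field.
  by rewrite /n; lra.
- transitivity ((x1 * y1 + x2 * y2) * x2); last by field.
  by rewrite /n; lra.
Qed.

(** The squared modulus of x y conj(z)^2, split into imaginary and real parts. *)
Lemma isogonal_normsq {R : realType} (x1 x2 y1 y2 z1 z2 : R) :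
  isogonal x1 x2 y1 y2 z1 z2 ^+ 2 +
  ((x1 * z1 + x2 * z2) * (y1 * z1 + y2 * z2) -
   (x1 * z2 - x2 * z1) * (y1 * z2 - y2 * z1)) ^+ 2 =
  (x1 * x1 + x2 * x2) * (y1 * y1 + y2 * y2) * (z1 * z1 + z2 * z2) ^+ 2.
Proof. by rewrite /isogonal; ring. Qed.

(** * Points, angles and lines of the hyperboloid seen from a point *)

(** By Cauchy-Schwarz the spatial dot product is at most the product of the spatial norms, which is
    smaller than the product of the time coordinates. *)
Lemma lorentz_lt0 {R : realType} {u v : 'rV[R]_3} :
  lorentz u u = -1 -> lorentz v v = -1 -> 0 < u 0 0 -> 0 < v 0 0 ->
  lorentz u v < 0.
Proof.
rewrite /lorentz; set u0 := u 0 0; set v0 := v 0 0; set u1 := u 0 1.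
set v1 := v 0 1; set u2 := u 0 2%:R; set v2 := v 0 2%:R => hu hv hu0 hv0.
rewrite ltNge; apply/negP => h.
have uv0 : 0 < u0 * v0 by rewrite mulr_gt0.
have h1 : (u0 * v0) ^+ 2 <= (u1 * v1 + u2 * v2) ^+ 2.
  by rewrite ler_sqr ?nnegrE; lra.
have h2 : (u0 * v0) ^+ 2 =
    (1 + (u1 * u1 + u2 * u2)) * (1 + (v1 * v1 + v2 * v2)).
  by rewrite exprMn !expr2; congr (_ * _); lra.
have := sqr_ge0 (u1 * v2 - u2 * v1).
have := sqr_ge0 u1; have := sqr_ge0 u2; have := sqr_ge0 v1.
have := sqr_ge0 v2; lra.
Qed.

(** Otherwise [- v] lies on the upper sheet and [lorentz_lt0] gives the wrong sign. *)
Lemma lorentz_lt0_future {R : realType} {u v : 'rV[R]_3} :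
  lorentz u u = -1 -> lorentz v v = -1 -> 0 < u 0 0 -> lorentz u v < 0 ->
  0 < v 0 0.
Proof.
move=> hu hv u0 huv; rewrite ltNge; apply/negP => v0.
have vn0 : v 0 0 != 0.
  apply/eqP => h; move: hv; rewrite /lorentz h.
  have := sqr_ge0 (v 0 1); have := sqr_ge0 (v 0 2%:R); lra.
have hv' : lorentz (- v) (- v) = -1.
  by rewrite -hv /lorentz !mxE; ring.
have : lorentz u (- v) < 0.
  by apply: lorentz_lt0 => //; rewrite mxE oppr_gt0 lt_neqAle vn0.
have -> : lorentz u (- v) = - lorentz u v by rewrite /lorentz !mxE; ring.
lra.
Qed.

Lemma hpoint_lorentz_lt0 {R : realType} (X Y : hpoint R) :
  lorentz (hvec X) (hvec Y) < 0.
Proof.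
by apply: lorentz_lt0; rewrite ?hpoint_norm //; exact: hvec0_gt0.
Qed.

Lemma lorentz_direction {R : realType} (P X Y : hpoint R) :
  lorentz (direction P X) (direction P Y) =
  coord1 P (hvec X) * coord1 P (hvec Y) + coord2 P (hvec X) * coord2 P (hvec Y).
Proof.
have nP := hpoint_norm P; have XY := lorentz_coord P (hvec X) (hvec Y).
transitivity (lorentz (hvec X) (hvec Y)
    + lorentz (hvec P) (hvec X) * lorentz (hvec P) (hvec Y)
    + lorentz (hvec P) (hvec X) * lorentz (hvec P) (hvec Y)
      * (1 + lorentz (hvec P) (hvec P))).
  by rewrite /direction /lorentz !mxE; ring.
by rewrite nP XY; ring.
Qed.

Lemma angle_plane {R : realType} (X P Y : hpoint R) :
  angle X P Y = plane_angle (coord1 P (hvec X)) (coord2 P (hvec X))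
                            (coord1 P (hvec Y)) (coord2 P (hvec Y)).
Proof. by rewrite /angle !lorentz_direction. Qed.

Lemma coord_neq0 {R : realType} {P X : hpoint R} :
  X != P -> ~ (coord1 P (hvec X) = 0 /\ coord2 P (hvec X) = 0).
Proof. by move=> /eqP XP [h1 h2]; apply: XP; apply: coord_eq0. Qed.

Lemma line_throughl {R : realType} (X Y : hpoint R) : line_through X Y X.
Proof. by exists 1, 0; rewrite scale1r scale0r addr0. Qed.

Lemma line_throughr {R : realType} (X Y : hpoint R) : line_through X Y Y.
Proof. by exists 0, 1; rewrite scale1r scale0r add0r. Qed.

Lemma is_line_through {R : realType} {X Y : hpoint R} :
  X != Y -> is_line (line_through X Y).
Proof. by move=> XY; exists X, Y. Qed.

(** The linear plane of [l] contains [hvec P], which both coordinates kill, so its image in the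
    tangent frame has dimension at most one. *)
Lemma line_parallel {R : realType} {l : set (hpoint R)} {P Z W : hpoint R} :
  is_line l -> l P -> l Z -> l W ->
  coord1 P (hvec Z) * coord2 P (hvec W) = coord2 P (hvec Z) * coord1 P (hvec W).
Proof.
move=> [X [Y [_ ->]]] [s [t hP]] [s1 [t1 ->]] [s2 [t2 ->]].
have h1 := coord1_base P; have h2 := coord2_base P.
rewrite hP coord1_linear in h1; rewrite hP coord2_linear in h2.
rewrite !coord1_linear !coord2_linear.
move: (coord1 P (hvec X)) (coord1 P (hvec Y)) h1 => x1 y1 h1.
move: (coord2 P (hvec X)) (coord2 P (hvec Y)) h2 => x2 y2 h2.
have hd : x1 * y2 - x2 * y1 = 0.
  have hs : s * (x1 * y2 - x2 * y1) = 0.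
    transitivity ((s * x1 + t * y1) * y2 - (s * x2 + t * y2) * y1); first by ring.
    by rewrite h1 h2; ring.
  have ht : t * (x1 * y2 - x2 * y1) = 0.
    transitivity ((s * x2 + t * y2) * x1 - (s * x1 + t * y1) * x2); first by ring.
    by rewrite h1 h2; ring.
  have [s0|s0] := eqVneq s 0; last first.
    by move: hs => /eqP; rewrite mulf_eq0 (negbTE s0) => /eqP.
  have [t0|t0] := eqVneq t 0; last first.
    by move: ht => /eqP; rewrite mulf_eq0 (negbTE t0) => /eqP.
  by have := hvec0_gt0 P; rewrite hP s0 t0 !scale0r addr0 mxE ltxx.
transitivity ((s1 * x2 + t1 * y2) * (s2 * x1 + t2 * y1)
   + (s1 * t2 - s2 * t1) * (x1 * y2 - x2 * y1)); first by ring.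
by rewrite hd; ring.
Qed.

Lemma line_opposite {R : realType} {l : set (hpoint R)} {P Z : hpoint R} :
  is_line l -> l P -> l Z ->
  exists Z' : hpoint R, [/\ l Z', coord1 P (hvec Z') = - coord1 P (hvec Z)
    & coord2 P (hvec Z') = - coord2 P (hvec Z)].
Proof.
move=> [X [Y [_ ->]]] [s [t hP]] [s1 [t1 hZ]].
(* [v] is the image of [Z] under the point reflection in [P]: the component along [P] is kept and
   the tangent one negated. *)
set c := lorentz (hvec P) (hvec Z).
set v := (- (2 * c)) *: hvec P + (-1) *: hvec Z.
have hv : in_hyperboloid v.
  have nP := hpoint_norm P; have nZ := hpoint_norm Z.
  have Pv : lorentz (hvec P) v = c by rewrite lorentz_linear nP -/c; ring.
  have nv : lorentz v v = -1.
    rewrite {2}/v lorentz_linear [lorentz v (hvec P)]lorentzC Pv.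
    rewrite [lorentz v (hvec Z)]lorentzC lorentz_linear nZ lorentzC -/c; ring.
  rewrite /in_hyperboloid nv eqxx andTb.

  apply: (lorentz_lt0_future nP nv (hvec0_gt0 P)).
  by rewrite Pv; exact: hpoint_lorentz_lt0.
exists (HPoint hv); split => /=.
- exists (- (2 * c) * s - s1), (- (2 * c) * t - t1) => /=.
  by rewrite /v {1}hP {1}hZ; apply/rowP => i; rewrite !mxE; ring.
- by rewrite coord1_linear coord1_base; ring.
- by rewrite coord2_linear coord2_base; ring.
Qed.

Lemma line_other_point {R : realType} {l : set (hpoint R)} (P : hpoint R) :
  is_line l -> exists Z, l Z /\ Z != P.
Proof.
move=> [X [Y [XY ->]]]; have [XP|XP] := eqVneq X P.
  by exists Y; split; [exact: line_throughr | rewrite -XP eq_sym].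
by exists X; split; [exact: line_throughl|].
Qed.

(** * Bisectors of two lines as a single equation *)

Definition isogonal_at {R : realType} (P X Y Z : hpoint R) : R :=
  isogonal (coord1 P (hvec X)) (coord2 P (hvec X))
           (coord1 P (hvec Y)) (coord2 P (hvec Y))
           (coord1 P (hvec Z)) (coord2 P (hvec Z)).

(** [isogonal] is homogeneous in each vector, so any points of the three lines other than [P] may
    represent them. Conversely, the equation fixes the lines only up to the choice of rays, and
    suitable rays are found by reflecting [V] and [Z] in [P]. *)
Lemma bisectorsP {R : realType} {P U V : hpoint R} 
    {a b : set (hpoint R)} (l : set (hpoint R)) :
  is_line a -> a P -> a U -> U != P -> is_line b -> b P -> b V -> V != P ->
  bisectors P a b l <->
  [/\ is_line l, l P & forall Z, l Z -> Z != P -> isogonal_at P U V Z = 0].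
Proof.
move=> la aP aU UP lb bP bV VP; split.
  move=> [ll lP [X [Y [Z [[aX XP] [bY YP] [lZ ZP] [h1 h2]]]]]].
  split=> // W lW WP; move: h1 h2; rewrite !angle_plane => h1 h2.
  have := bisecting_isogonal (coord_neq0 XP) (coord_neq0 YP) (coord_neq0 ZP) h1 h2.
  have [k [Uk1 Uk2]] := parallel_scale (coord_neq0 XP) (line_parallel la aP aX aU).
  have [m [Vm1 Vm2]] := parallel_scale (coord_neq0 YP) (line_parallel lb bP bY bV).
  have [n [Wn1 Wn2]] := parallel_scale (coord_neq0 ZP) (line_parallel ll lP lZ lW).
  rewrite /isogonal_at Uk1 Uk2 Vm1 Vm2 Wn1 Wn2 => h.
  transitivity (k * m * n ^+ 2 * isogonal (coord1 P (hvec X)) (coord2 P (hvec X))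
           (coord1 P (hvec Y)) (coord2 P (hvec Y))
           (coord1 P (hvec Z)) (coord2 P (hvec Z))).
    by rewrite /isogonal; ring.
  by rewrite h mulr0.
move=> [ll lP h]; split=> //.
have [Z [lZ ZP]] := line_other_point P ll.
have {}h := h Z lZ ZP; rewrite /isogonal_at in h.
have hU := coord_neq0 UP; have hV := coord_neq0 VP; have hZ := coord_neq0 ZP.
have [V' [Z' [bV' lZ' [hV' hZ' h0 hz hre]]]] : exists V' Z' : hpoint R,
    [/\ b V', l Z' &
     let u1 := coord1 P (hvec U) in let u2 := coord2 P (hvec U) in
     let v1 := coord1 P (hvec V') in let v2 := coord2 P (hvec V') in
     let z1 := coord1 P (hvec Z') in let z2 := coord2 P (hvec Z') in
     [/\ ~ (v1 = 0 /\ v2 = 0), ~ (z1 = 0 /\ z2 = 0),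
       isogonal u1 u2 v1 v2 z1 z2 = 0, 0 <= u1 * z1 + u2 * z2 &
       0 < (u1 * z1 + u2 * z2) * (v1 * z1 + v2 * z2) -
           (u1 * z2 - u2 * z1) * (v1 * z2 - v2 * z1)]].
  have [Vo [bVo Vo1 Vo2]] := line_opposite lb bP bV.
  have [Zo [lZo Zo1 Zo2]] := line_opposite ll lP lZ.
  have := isogonal_normsq (coord1 P (hvec U)) (coord2 P (hvec U))
    (coord1 P (hvec V)) (coord2 P (hvec V)) (coord1 P (hvec Z)) (coord2 P (hvec Z)).
  rewrite h expr0n add0r; set re := (X in X ^+ 2 = _) => hre.
  (* The number x y conj(z)^2 is nonzero with zero imaginary part. *)
  have re0 : re != 0.
    rewrite -sqrf_eq0 hre !mulf_neq0 ?expf_neq0 //;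
      by apply/eqP => /vec_normsq_eq0.
  have [V' [bV' [hV' hi hp]]] : exists V' : hpoint R, [/\ b V' &
     let u1 := coord1 P (hvec U) in let u2 := coord2 P (hvec U) in
     let v1 := coord1 P (hvec V') in let v2 := coord2 P (hvec V') in
     let z1 := coord1 P (hvec Z) in let z2 := coord2 P (hvec Z) in
     [/\ ~ (v1 = 0 /\ v2 = 0), isogonal u1 u2 v1 v2 z1 z2 = 0 &
       0 < (u1 * z1 + u2 * z2) * (v1 * z1 + v2 * z2) -
           (u1 * z2 - u2 * z1) * (v1 * z2 - v2 * z1)]].
    (* Replacing [V] by its opposite negates the real part [re]. *)
    have [re_lt|re_ge] := ltP re 0; last first.
      exists V; split=> //; split=> //.
      by rewrite -/re lt_neqAle eq_sym re0.
    exists Vo; split=> //; rewrite Vo1 Vo2; split.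
    - by move=> [/eqP + /eqP]; rewrite !oppr_eq0 => /eqP ? /eqP ?; apply: hV.
    - by move: h; rewrite /isogonal; lra.
    - by move: re_lt; rewrite /re; lra.
  (* Replacing [Z] by its opposite makes the angle from [U] nonobtuse and preserves the real part,
     which is quadratic in [Z]. *)
  have [z_lt|z_ge] := ltP (coord1 P (hvec U) * coord1 P (hvec Z) +
                           coord2 P (hvec U) * coord2 P (hvec Z)) 0; last first.
    by exists V', Z.
  exists V', Zo; split=> //; rewrite Zo1 Zo2; split=> //.
  - by move=> [/eqP + /eqP]; rewrite !oppr_eq0 => /eqP ? /eqP ?; apply: hZ.
  - by rewrite -[RHS]hi /isogonal; ring.
  - by lra.
  - by move: hp => /=; lra.
have [e1 e2] := isogonal_bisecting hU hV' hZ' h0 hz hre.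
have neP (W : hpoint R) :
    ~ (coord1 P (hvec W) = 0 /\ coord2 P (hvec W) = 0) -> W != P.
  by move=> hW; apply/eqP => WP; apply: hW; rewrite WP coord1_base coord2_base.
exists U, V', Z'; split=> //; [by split=> //; apply: neP..|].
by rewrite /bisects !angle_plane.
Qed.

(** * Noncollinear points are distinct *)

Lemma hpoint_other {R : realType} (X : hpoint R) : exists Y : hpoint R, Y != X.
Proof.
(* One spatial coordinate is shifted by 1, and the time coordinate lifts the result back to the
   sheet. *)
pose f (i : 'I_3) : R := if i == 0 then
    Num.sqrt (1 + (hvec X 0 1 + 1) ^+ 2 + hvec X 0 2%:R ^+ 2)
  else if i == 1 then hvec X 0 1 + 1 else hvec X 0 2%:R.
set n := 1 + (hvec X 0 1 + 1) ^+ 2 + hvec X 0 2%:R ^+ 2 in f.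
have n0 : 0 < n by rewrite !ltr_wpDr ?sqr_ge0.
have hv : in_hyperboloid (\row_i f i).
  rewrite /in_hyperboloid /lorentz !mxE /f /= sqrtr_gt0 n0 andbT -expr2.
  by rewrite sqr_sqrtr ?ltW // /n; apply/eqP; ring.
exists (HPoint hv); apply/eqP => /(congr1 (fun Z => hvec Z 0 1)).
by rewrite /= mxE /f /=; lra.
Qed.

Lemma line_exists {R : realType} (X Y : hpoint R) :
  exists l : set (hpoint R), [/\ is_line l, l X & l Y].
Proof.
have [<-|XY] := eqVneq X Y; last first.
  exists (line_through X Y); split; [exact: is_line_through
    | exact: line_throughl | exact: line_throughr].
have [Z ZX] := hpoint_other X; exists (line_through Z X).
by split; [exact: is_line_through | exact: line_throughr..].
Qed.

Lemma noncollinear_neq {R : realType} {X Y Z : hpoint R} :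
  ~ collinear X Y Z -> [/\ X != Y, Y != Z & X != Z].
Proof.
move=> h; split; apply/eqP => E; apply: h.
- by have [l [? ? ?]] := line_exists Y Z; exists l; rewrite E.
- by have [l [? ? ?]] := line_exists X Z; exists l; rewrite E.
- by have [l [? ? ?]] := line_exists Z Y; exists l; rewrite E.
Qed.

(** * Right angles in the Klein model and the complex-number argument *)

(** The hyperbolic Pythagorean theorem: [- lorentz] is the cosh of the distance. *)
Lemma right_angleE {R : realType} {X P Y : hpoint R} :
  angle X P Y = pi / 2 ->
  lorentz (hvec X) (hvec Y)
    + lorentz (hvec P) (hvec X) * lorentz (hvec P) (hvec Y) = 0.
Proof.
rewrite angle_plane => /plane_angle_right h.
by rewrite (lorentz_coord P) subrK.
Qed.

(** The tangent coordinates of [Y] at [P] are a multiple of those of [X], zero if [Y = P], so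
    orthogonality to [W] carries over. *)
Lemma right_angle_line {R : realType} {l : set (hpoint R)} {P W X Y : hpoint R} :
  is_line l -> l P -> l X -> X != P -> l Y ->
  lorentz (hvec W) (hvec X)
    + lorentz (hvec P) (hvec W) * lorentz (hvec P) (hvec X) = 0 ->
  lorentz (hvec W) (hvec Y)
    + lorentz (hvec P) (hvec W) * lorentz (hvec P) (hvec Y) = 0.
Proof.
move=> ll lP lX XP lY; rewrite !(lorentz_coord P (hvec W)) !subrK.
have [k [-> ->]] := parallel_scale (coord_neq0 XP) (line_parallel ll lP lX lY).
move=> h; rewrite mulrCA [_ * (k * _)]mulrCA -mulrDr h mulr0 //.
Qed.

(* Dividing the coordinates of [X] at [P] by [- lorentz P X] gives its image in the
   Klein model centred at [P]; there right angles at [X] towards [P] are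
   Euclidean. *)
Lemma right_angle_klein {R : realType} {A B P : hpoint R} :
  lorentz (hvec A) (hvec P)
    + lorentz (hvec B) (hvec A) * lorentz (hvec B) (hvec P) = 0 ->
  lorentz (hvec P) (hvec A) * (coord1 P (hvec B) * coord1 P (hvec B) +
                               coord2 P (hvec B) * coord2 P (hvec B)) =
  lorentz (hvec P) (hvec B) * (coord1 P (hvec A) * coord1 P (hvec B) +
                               coord2 P (hvec A) * coord2 P (hvec B)).
Proof.
have := hpoint_norm B; rewrite (lorentz_coord P (hvec B) (hvec B)).
rewrite (lorentzC (hvec A)) (lorentzC (hvec B) (hvec P)).
rewrite (lorentz_coord P (hvec B) (hvec A)).
move: (lorentz (hvec P) (hvec A)) (lorentz (hvec P) (hvec B)) => a0 b0.
move=> h1 h2; have h3 := congr1 ( *%R a0) h1; lra.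
Qed.

Lemma complex_aligned {R : realType} {m1 m2 n1 n2 s1 s2 : R} :
  ~ (m1 = 0 /\ m2 = 0) -> m1 * n2 = m2 * n1 -> m1 * s2 = m2 * s1 ->
  n1 * s2 = n2 * s1.
Proof.
move=> m0 hn hs.
have [k [-> ->]] := parallel_scale m0 hn.
have [h [-> ->]] := parallel_scale m0 hs; ring.
Qed.

Lemma complex_mul_neq0 {R : realType} {x1 x2 y1 y2 : R} :
  ~ (x1 = 0 /\ x2 = 0) -> ~ (y1 = 0 /\ y2 = 0) ->
  ~ (x1 * y1 - x2 * y2 = 0 /\ x1 * y2 + x2 * y1 = 0).
Proof.
move=> x0 y0 [h1 h2].
have : (x1 * x1 + x2 * x2) * (y1 * y1 + y2 * y2) = 0.
  transitivity ((x1 * y1 - x2 * y2) ^+ 2 + (x1 * y2 + x2 * y1) ^+ 2).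
    by ring.
  by rewrite h1 h2; ring.
by move=> /eqP; rewrite mulf_eq0 => /orP[] /eqP /vec_normsq_eq0.
Qed.

(* The third hypothesis says, in complex notation, that [x y / (u v)] is real. *)
Lemma isogonal_transfer {R : realType} {x1 x2 y1 y2 u1 u2 v1 v2 z1 z2 : R} :
  ~ (x1 = 0 /\ x2 = 0) -> ~ (y1 = 0 /\ y2 = 0) ->
  (x1 * y1 - x2 * y2) * (u1 * v2 + u2 * v1) =
  (x1 * y2 + x2 * y1) * (u1 * v1 - u2 * v2) ->
  isogonal x1 x2 y1 y2 z1 z2 = 0 -> isogonal u1 u2 v1 v2 z1 z2 = 0.
Proof.
move=> x0 y0 hxu hz; have m0 := complex_mul_neq0 x0 y0.
(* With [s] = z^2: both u v and z^2 are real multiples of x y. *)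
have := complex_aligned m0 hxu (s1 := z1 ^+ 2 - z2 ^+ 2) (s2 := z1 * z2 *+ 2).
move: hz; rewrite /isogonal => hz H.
have {}H := H ltac:(lra); lra.
Qed.

(** The final computation with Klein coordinates kept homogeneous: [b0], [d0], [a0] are the
    denominators, and e = d0 b - b0 d is proportional to the difference of the Klein images of b and
    d. *)
Lemma diametral_aligned {R : realType} {a0 a1 a2 b0 b1 b2 d0 d1 d2 q1 q2 : R} :
  a0 != 0 -> ~ (d0 * b1 - b0 * d1 = 0 /\ d0 * b2 - b0 * d2 = 0) ->
  a0 * (b1 * b1 + b2 * b2) = b0 * (a1 * b1 + a2 * b2) ->
  a0 * (d1 * d1 + d2 * d2) = d0 * (a1 * d1 + a2 * d2) ->
  q1 * (d0 * b1 - b0 * d1) + q2 * (d0 * b2 - b0 * d2) = 0 ->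
  (b1 * d1 - b2 * d2) * (a1 * q2 + a2 * q1) =
  (b1 * d2 + b2 * d1) * (a1 * q1 - a2 * q2).
Proof.
set e1 := d0 * b1 - b0 * d1; set e2 := d0 * b2 - b0 * d2 => a00 e0 hb hd hq.
(* Being orthogonal to e, q is a real multiple of i e. *)
have [k [-> ->]] : exists k, q1 = k * - e2 /\ q2 = k * e1.
  apply: parallel_scale; last by lra.
  by move=> [/eqP]; rewrite oppr_eq0 => /eqP e2z e1z; apply: e0.
(* Both sides equal [a0] |b|^2 |d|^2. *)
have h : (b1 * b1 + b2 * b2) * (d0 * (a1 * d1 + a2 * d2)) =
         (d1 * d1 + d2 * d2) * (b0 * (a1 * b1 + a2 * b2)).
  by rewrite -hb -hd; ring.
apply/eqP; rewrite -subr_eq0; apply/eqP.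
transitivity (k * ((b1 * b1 + b2 * b2) * (d0 * (a1 * d1 + a2 * d2)) -
                   (d1 * d1 + d2 * d2) * (b0 * (a1 * b1 + a2 * b2)))).
  by rewrite /e1 /e2; ring.
by rewrite h subrr mulr0.
Qed.

(** Equal Klein images and equal norms give equal squares of the time coordinates, hence [b0 = d0]
    since both are negative; then the spatial coordinates agree too. *)
Lemma klein_inj {R : realType} {P B D : hpoint R} :
  lorentz (hvec P) (hvec D) * coord1 P (hvec B) =
    lorentz (hvec P) (hvec B) * coord1 P (hvec D) ->
  lorentz (hvec P) (hvec D) * coord2 P (hvec B) =
    lorentz (hvec P) (hvec B) * coord2 P (hvec D) -> B = D.
Proof.
have b0 := hpoint_lorentz_lt0 P B; have d0 := hpoint_lorentz_lt0 P D.
have nB := hpoint_norm B; have nD := hpoint_norm D.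
have BD := lorentz_coord P (hvec B) (hvec D).
have BD' := lorentz_coord D (hvec B) (hvec B).
rewrite (lorentz_coord P) in nB; rewrite (lorentz_coord P) in nD.
rewrite [in LHS](lorentz_coord P) (lorentzC (hvec D)) BD in BD'.
move: (lorentz (hvec P) (hvec B)) (lorentz (hvec P) (hvec D)) b0 d0 nB nD BD BD'.
move: (coord1 P (hvec B)) (coord2 P (hvec B)) => b1 b2.
move: (coord1 P (hvec D)) (coord2 P (hvec D)) => d1 d2.
move=> b0 d0 hb0 hd0 nB nD BD BD' h1 h2.
have bd : b0 = d0.
  have : d0 ^+ 2 = b0 ^+ 2.
    have : (d0 * b1) ^+ 2 + (d0 * b2) ^+ 2 = (b0 * d1) ^+ 2 + (b0 * d2) ^+ 2.
      by rewrite h1 h2.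
    have := congr1 ( *%R (d0 ^+ 2)) nB; have := congr1 ( *%R (b0 ^+ 2)) nD.
    by lra.
  by move=> /eqP; rewrite eqf_sqr => /orP[] /eqP; lra.
have dn0 : d0 != 0 by rewrite lt_eqF.
move: h1 h2; rewrite bd => /(mulfI dn0) h1 /(mulfI dn0) h2.
(* Now [lorentz (hvec B) (hvec D)] is -1, so the coordinates of [B] in the frame at [D] have norm
   zero. *)
have [] := @vec_normsq_eq0 R (coord1 D (hvec B)) (coord2 D (hvec B)).
  by rewrite h1 h2 bd nD in BD'; lra.
by apply: coord_eq0.
Qed.

(** With [q0], [b0], [d0] the values of [lorentz (hvec P)], the hypotheses read q0 (q.b) = (q0^2 -
    1) b0 and q0 (q.d) = (q0^2 - 1) d0; cross-multiplying by d0 and b0 cancels the right-hand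
    sides. *)
Lemma foot_klein_orthogonal {R : realType} {P Q B D : hpoint R} :
  lorentz (hvec P) (hvec B)
    + lorentz (hvec Q) (hvec P) * lorentz (hvec Q) (hvec B) = 0 ->
  lorentz (hvec P) (hvec D)
    + lorentz (hvec Q) (hvec P) * lorentz (hvec Q) (hvec D) = 0 ->
  coord1 P (hvec Q) * (lorentz (hvec P) (hvec D) * coord1 P (hvec B) -
                       lorentz (hvec P) (hvec B) * coord1 P (hvec D)) +
  coord2 P (hvec Q) * (lorentz (hvec P) (hvec D) * coord2 P (hvec B) -
                       lorentz (hvec P) (hvec B) * coord2 P (hvec D)) = 0.
Proof.
have q0 := hpoint_lorentz_lt0 P Q.
rewrite (lorentzC (hvec Q) (hvec P)) !(lorentz_coord P (hvec Q)) => hB hD.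
have qn0 : lorentz (hvec P) (hvec Q) != 0 by rewrite lt_eqF.
apply: (mulfI qn0); rewrite mulr0.
have := congr1 ( *%R (lorentz (hvec P) (hvec D))) hB.
have := congr1 ( *%R (lorentz (hvec P) (hvec B))) hD.
lra.
Qed.

(** * Comparison of the two pairs of bisectors at [A'] *)

Theorem theorem10 (R : realType) (A B1 A' D1 : hpoint R)
  (hdiam : diametral A B1 A' D1)
  (hB1 : angle A B1 A' = pi / 2)
  (hD1 : angle A' D1 A = pi / 2)
  (c : set (hpoint R))
  (hc : is_line c)
  (hcA' : c A')
  (hcperp : perpendicular c (line_through B1 D1)) :
  bisectors A' (line_through A' B1) (line_through A' D1) =
  bisectors A' (line_through A A') c.
Proof.
have [[ABP BPD _ _] _] := hdiam.
have [_ BP AP] := noncollinear_neq ABP.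
have [_ PD BD] := noncollinear_neq BPD.
have [Q [X [Y [[cQ bdQ] [cX XQ] [bdY YQ] hQ]]]] := hcperp.
have lbd := is_line_through BD.
(* Otherwise [A'] would lie on the diagonal through [B1] and [D1]. *)
have QP : Q != A'.
  apply/eqP => QP; apply: BPD; exists (line_through B1 D1); split=> //.
  - exact: line_throughl.
  - by rewrite -QP.
  - exact: line_throughr.
(* The right angle at the foot [Q] is moved along [c] from [X] to [A'], then along the diagonal from
   [Y] to [B1] and [D1]. *)
have hYP : lorentz (hvec Y) (hvec A')
    + lorentz (hvec Q) (hvec Y) * lorentz (hvec Q) (hvec A') = 0.
  apply: (right_angle_line hc cQ cX XQ hcA').
  by rewrite lorentzC mulrC; exact: right_angleE.
have foot W : line_through B1 D1 W -> lorentz (hvec A') (hvec W)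
    + lorentz (hvec Q) (hvec A') * lorentz (hvec Q) (hvec W) = 0.
  move=> bdW; apply: (right_angle_line lbd bdQ bdY YQ bdW).
  by rewrite lorentzC mulrC.
have horth := foot_klein_orthogonal (foot _ (line_throughl B1 D1))
  (foot _ (line_throughr B1 D1)).
have hb := right_angle_klein (right_angleE hB1).
have hd : lorentz (hvec A) (hvec A')
    + lorentz (hvec D1) (hvec A) * lorentz (hvec D1) (hvec A') = 0.
  by rewrite lorentzC mulrC; exact: right_angleE.
have {}hd := right_angle_klein hd.
have a0 : lorentz (hvec A') (hvec A) != 0.
  by rewrite lt_eqF // hpoint_lorentz_lt0.
have hbd : ~ (lorentz (hvec A') (hvec D1) * coord1 A' (hvec B1) -
              lorentz (hvec A') (hvec B1) * coord1 A' (hvec D1) = 0 /\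
              lorentz (hvec A') (hvec D1) * coord2 A' (hvec B1) -
              lorentz (hvec A') (hvec B1) * coord2 A' (hvec D1) = 0).
  move=> [/eqP + /eqP]; rewrite !subr_eq0 => /eqP h1 /eqP h2.
  by move: BD; rewrite (klein_inj h1 h2) eqxx.
(* In complex notation, b d / (a q) is real; this relation serves for both inclusions. *)
have key := diametral_aligned a0 hbd hb hd horth.
have DP : D1 != A' by rewrite eq_sym.
have PB : A' != B1 by rewrite eq_sym.
apply/seteqP; split=> l.
- move=> /(bisectorsP _ (is_line_through PB) (line_throughl _ _)
    (line_throughr _ _) BP (is_line_through PD) (line_throughl _ _)
    (line_throughr _ _) DP)[ll lP h].
  apply/(bisectorsP _ (is_line_through AP) (line_throughr _ _)
    (line_throughl _ _) AP hc hcA' cQ QP); split=> // Z lZ ZP.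
  exact: (isogonal_transfer (coord_neq0 BP) (coord_neq0 DP) key (h Z lZ ZP)).
- move=> /(bisectorsP _ (is_line_through AP) (line_throughr _ _)
    (line_throughl _ _) AP hc hcA' cQ QP)[ll lP h].
  apply/(bisectorsP _ (is_line_through PB) (line_throughl _ _)
    (line_throughr _ _) BP (is_line_through PD) (line_throughl _ _)
    (line_throughr _ _) DP); split=> // Z lZ ZP.
  apply: (isogonal_transfer (coord_neq0 AP) (coord_neq0 QP) _ (h Z lZ ZP)).
  by move: key; lra.
Qed.
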